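(* The monoid $\mathscr F^+$, generated under composition by the eleven functors $\mathbb O,\mathbb E,\mathbb G,\mathbb G_L,\mathbb G_R,\mathbb G_{LR},\mathbb F,\mathbb F_L,\mathbb F_R,\mathbb F_{LR},\mathbb I$ on the category of monoids, has size $15$.
   Context: $\mathcal M$ is the category of all monoids, with homomorphisms preserving identities; submonoids contain the identity. An element $x$ of a monoid $M$ is a left unit if $ax=1$ for some $a\in M$, a right unit if $xa=1$ for some $a\in M$. $\langle A\rangle$ denotes the submonoid generated by $A$. For a monoid $M$ define submonoids: $\mathbb O(M)=\{1\}$; $\mathbb I(M)=M$; $\mathbb E(M)$ is generated by all idempotents of $M$; $\mathbb G_L(M)$ is the set of left units; $\mathbb G_R(M)$ the set of right units; $\mathbb G(M)=\mathbb G_L(M)\cap\mathbb G_R(M)$; $\mathbb G_{LR}(M)=\langle\mathbb G_L(M)\cup\mathbb G_R(M)\rangle$; $\mathbb F(M)=\langle\mathbb E(M)\cup\mathbb G(M)\rangle$; $\mathbb F_L(M)=\langle\mathbb E(M)\cup\mathbb G_L(M)\rangle$; $\mathbb F_R(M)=\langle\mathbb E(M)\cup\mathbb G_R(M)\rangle$; $\mathbb F_{LR}(M)=\langle\mathbb E(M)\cup\mathbb G_L(M)\cup\mathbb G_R(M)\rangle$. Each such $\mathbb X$ is a functor $\mathcal M\to\mathcal M$: for a homomorphism $f:M\to N$, $\mathbb X(f):\mathbb X(M)\to\mathbb X(N)$ is the restriction of $f$. Composition is $(\mathbb X\circ\mathbb Y)(M)=\mathbb X(\mathbb Y(M))$,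 regarded as a submonoid of $M$; two composites are equal iff they give the same submonoid of $M$ for every monoid $M$. The identity of the monoid $\mathscr F^+$ is $\mathbb I$. *)

(* Defs.v *)
From HB Require Import structures.
From mathcomp Require Import all_boot.
From mathcomp Require Import boolp classical_sets functions cardinality.
Set Implicit Arguments.
Unset Strict Implicit.
Unset Printing Implicit Defensive.

Local Open Scope classical_set_scope.
Local Open Scope group_scope.

(* A [monoidType] carries a [choiceType] structure on its elements. With the
   classical axioms of [boolp] every type has one, so that [monoidType] covers
   all monoids. *)

Record submonoid (M : monoidType) := Submonoid {
  subm_set : set M;
  subm_closed : monoid_closed [in subm_set] }.

Section Submonoid.
Variable M : monoidType.
Implicit Types (S : submonoid M) (A : set M).

Lemma subm1 S : subm_set S 1.
Proof. exact/set_mem/(subm_closed S).1. Qed.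

Lemma submM S x y : subm_set S x -> subm_set S y -> subm_set S (x * y).
Proof.
by move=> /mem_set Sx /mem_set Sy; apply/set_mem/(subm_closed S).2.
Qed.

Lemma submonoid_eq S T : subm_set S = subm_set T -> S = T.
Proof.
by case: S T => [A hA] [B hB] /= AB; subst B; rewrite (Prop_irrelevance hA hB).
Qed.

Lemma monoid_closedP A :
  A 1 -> (forall x y, A x -> A y -> A (x * y)) -> monoid_closed [in A].
Proof.
move=> A1 AM; split; first exact/mem_set.
by move=> x y /set_mem Ax /set_mem Ay; apply/mem_set/AM.
Qed.

(* The submonoid S seen as a monoid in its own right, so that functors can be
   applied to it. *)
Definition subm_type S : Type := {x : M | x \in subm_set S}.

HB.instance Definition _ S := SubChoice.on (subm_type S).
HB.instance Definition _ S :=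
  SubChoice_isSubMonoid.Build M [in subm_set S] (subm_type S) (subm_closed S).

Lemma generated_closed A :
  monoid_closed [in smallest (fun B : set M => monoid_closed [in B]) A].
Proof.
apply: monoid_closedP; first by move=> B [cB _]; apply/set_mem/cB.1.
move=> x y xA yA B BP; apply/set_mem/BP.1.2.
  exact/mem_set/(xA _ BP).
exact/mem_set/(yA _ BP).
Qed.

Definition generated A : submonoid M := Submonoid (generated_closed A).

Definition idempotents : set M := [set e | e * e = e].
Definition left_units : set M := [set x | exists a, a * x = 1].
Definition right_units : set M := [set x | exists a, x * a = 1].

End Submonoid.

Coercion subm_type : submonoid >-> Sortclass.

Lemma generated_hom (M N : monoidType) (f : UMagmaMorphism.type M N)
    (A : set M) (B : set N) :
  (forall x, A x -> B (f x)) ->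
  forall x, subm_set (generated A) x -> subm_set (generated B) (f x).
Proof.
move=> fAB x; suff: subm_set (generated A) `<=` f @^-1` subm_set (generated B) by apply.
apply: smallest_sub; last first.
  by move=> y Ay; apply: sub_gen_smallest; exact: fAB.
apply: monoid_closedP; first by rewrite /preimage /= gmulf1; exact: (subm1 (generated B)).
by move=> y z fy fz; rewrite /preimage /= gmulfM; exact: (submM (S := generated B)).
Qed.

Lemma idempotents_hom (M N : monoidType) (f : UMagmaMorphism.type M N) x :
  idempotents x -> idempotents (f x).
Proof. by rewrite /idempotents /= -gmulfM => ->. Qed.

Lemma left_units_hom (M N : monoidType) (f : UMagmaMorphism.type M N) x :
  left_units x -> left_units (f x).
Proof. by move=> [a ax]; exists (f a); rewrite -gmulfM ax gmulf1. Qed.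

Lemma right_units_hom (M N : monoidType) (f : UMagmaMorphism.type M N) x :
  right_units x -> right_units (f x).
Proof. by move=> [a ax]; exists (f a); rewrite -gmulfM ax gmulf1. Qed.

Lemma left_units_closed (M : monoidType) : monoid_closed [in @left_units M].
Proof.
apply: monoid_closedP; first by exists 1; rewrite mulg1.
move=> x y [a ax] [b yb]; exists (b * a).
by rewrite -mulgA (mulgA a) ax mul1g.
Qed.

Lemma right_units_closed (M : monoidType) : monoid_closed [in @right_units M].
Proof.
apply: monoid_closedP; first by exists 1; rewrite mulg1.
move=> x y [a xa] [b yb]; exists (b * a).
by rewrite mulgA -(mulgA x) yb mulg1.
Qed.

(* A functor X from monoids to monoids such that X(M) is a submonoid of M and
   X(f) is the restriction of f: its action on morphisms is determined by
   [sf_obj], and it exists by [sf_hom]. *)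
Record subfunctor := Subfunctor {
  sf_obj :> forall M : monoidType, submonoid M;
  sf_hom : forall (M N : monoidType) (f : UMagmaMorphism.type M N) (x : M),
    subm_set (sf_obj M) x -> subm_set (sf_obj N) (f x) }.

(* Hence Leibniz equality of subfunctors is the intended equality. *)
Lemma subfunctorP (X Y : subfunctor) :
  X = Y <-> forall M : monoidType, subm_set (X M) = subm_set (Y M).
Proof.
split=> [-> //|]; case: X Y => [X hX] [Y hY] /= XY.
have E : X = Y by apply: functional_extensionality_dep => M; exact/submonoid_eq.
by subst Y; rewrite (Prop_irrelevance hX hY).
Qed.

Section Map.
Variables (X : subfunctor) (M N : monoidType) (f : UMagmaMorphism.type M N).

Fact sf_map_subproof (u : X M) : f (\val u) \in subm_set (X N).
Proof. exact/mem_set/sf_hom/set_mem/(valP u). Qed.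

Definition sf_map (u : X M) : X N := Sub (f (\val u)) (sf_map_subproof u).

Lemma val_sf_map u : \val (sf_map u) = f (\val u).
Proof. by []. Qed.

Fact sf_map_morphism : monoid_morphism sf_map.
Proof.
split; first by apply: val_inj; rewrite val_sf_map !val1 gmulf1.
by move=> u v; apply: val_inj; rewrite valM !val_sf_map valM gmulfM.
Qed.

HB.instance Definition _ := isUMagmaMorphism.Build (X M) (X N) sf_map
  sf_map_morphism.

End Map.

Section Composition.
Variables X Y : subfunctor.

Definition sf_comp_set (M : monoidType) : set M :=
  [set \val u | u in subm_set (X (Y M))].

Fact sf_comp_closed (M : monoidType) : monoid_closed [in @sf_comp_set M].
Proof.
apply: monoid_closedP; first by exists 1; [exact: subm1|exact: val1].
move=> _ _ [u Xu <-] [v Xv <-]; exists (u * v); first exact: submM.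
exact: valM.
Qed.

Fact sf_comp_hom (M N : monoidType) (f : UMagmaMorphism.type M N) (x : M) :
  sf_comp_set x -> sf_comp_set (f x).
Proof.
move=> [u Xu <-]; exists (sf_map f u); first exact: sf_hom.
exact: val_sf_map.
Qed.

Definition sf_comp : subfunctor :=
  Subfunctor (sf_obj := fun M => Submonoid (sf_comp_closed M)) sf_comp_hom.

End Composition.

Section Generated.
Variable A : forall M : monoidType, set M.
Hypothesis A_hom : forall (M N : monoidType) (f : UMagmaMorphism.type M N) x,
  A x -> A (f x).

Definition sf_generated : subfunctor :=
  Subfunctor (sf_obj := fun M => generated (@A M))
    (fun M N f => generated_hom (@A_hom M N f)).

End Generated.

Section Functors.
Variables (M N : monoidType) (f : UMagmaMorphism.type M N).

Fact O_closed : monoid_closed [in [set 1 : M]].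
Proof. by apply: monoid_closedP => // x y -> ->; rewrite /= mulg1. Qed.

Fact O_hom (x : M) : [set 1] x -> [set 1] (f x).
Proof. by move=> ->; rewrite /= gmulf1. Qed.

Fact I_closed : monoid_closed [in [set: M]].
Proof. exact: monoid_closedP. Qed.

Fact I_hom (x : M) : [set: M] x -> [set: N] (f x).
Proof. by []. Qed.

Fact G_closed : monoid_closed [in @left_units M `&` @right_units M].
Proof.
apply: monoid_closedP.
  by split; apply/set_mem; [apply: (left_units_closed M).1
                           |apply: (right_units_closed M).1].
move=> x y [/mem_set xl /mem_set xr] [/mem_set yl /mem_set yr].
by split; apply/set_mem; [apply: (left_units_closed M).2
                         |apply: (right_units_closed M).2].
Qed.

Fact G_hom (x : M) :
  (@left_units M `&` @right_units M) x -> (@left_units N `&` @right_units N) (f x).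
Proof. by move=> [? ?]; split; [exact: left_units_hom|exact: right_units_hom]. Qed.

Fact setU_hom (X Y : subfunctor) (x : M) :
  (subm_set (X M) `|` subm_set (Y M)) x -> (subm_set (X N) `|` subm_set (Y N)) (f x).
Proof. by move=> [?|?]; [left|right]; exact: sf_hom. Qed.

Fact setU3_hom (X Y Z : subfunctor) (x : M) :
  (subm_set (X M) `|` subm_set (Y M) `|` subm_set (Z M)) x -> (subm_set (X N) `|` subm_set (Y N) `|` subm_set (Z N)) (f x).
Proof.
by move=> [[?|?]|?]; [left; left|left; right|right]; exact: sf_hom.
Qed.

End Functors.

Definition sf_O := Subfunctor (sf_obj := fun M => Submonoid (@O_closed M)) O_hom.
Definition sf_I := Subfunctor (sf_obj := fun M => Submonoid (@I_closed M)) I_hom.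
Definition sf_E := sf_generated idempotents_hom.
Definition sf_GL :=
  Subfunctor (sf_obj := fun M => Submonoid (@left_units_closed M)) left_units_hom.
Definition sf_GR :=
  Subfunctor (sf_obj := fun M => Submonoid (@right_units_closed M)) right_units_hom.
Definition sf_G := Subfunctor (sf_obj := fun M => Submonoid (@G_closed M)) G_hom.

Definition sf_join (X Y : subfunctor) :=
  sf_generated (A := fun M => subm_set (X M) `|` subm_set (Y M))
    (fun M N f => @setU_hom M N f X Y).
Definition sf_join3 (X Y Z : subfunctor) :=
  sf_generated (A := fun M => subm_set (X M) `|` subm_set (Y M) `|` subm_set (Z M))
    (fun M N f => @setU3_hom M N f X Y Z).

Definition sf_GLR := sf_join sf_GL sf_GR.
Definition sf_F := sf_join sf_E sf_G.
Definition sf_FL := sf_join sf_E sf_GL.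
Definition sf_FR := sf_join sf_E sf_GR.
Definition sf_FLR := sf_join3 sf_E sf_GL sf_GR.

(* The submonoid generated by the eleven functors; its identity is [sf_I]. It is
   an inductive predicate rather than a [set], and its size is expressed by a
   bijection with an ordinal rather than by [card_eq], because the universe
   of [set] lies below that of a type quantifying over all monoids. *)
Inductive Fplus : subfunctor -> Prop :=
| Fplus_O : Fplus sf_O
| Fplus_E : Fplus sf_E
| Fplus_G : Fplus sf_G
| Fplus_GL : Fplus sf_GL
| Fplus_GR : Fplus sf_GR
| Fplus_GLR : Fplus sf_GLR
| Fplus_F : Fplus sf_F
| Fplus_FL : Fplus sf_FL
| Fplus_FR : Fplus sf_FR
| Fplus_FLR : Fplus sf_FLR
| Fplus_I : Fplus sf_I
| Fplus_comp X Y : Fplus X -> Fplus Y -> Fplus (sf_comp X Y).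

Section Transport.
Variables (K M : monoidType) (f : UMagmaMorphism.type K M) (S : submonoid M).
Hypothesis f_inj : injective f.
Hypothesis f_range : subm_set S = range f.

Fact corestrict_subproof (x : K) : f x \in subm_set S.
Proof. by rewrite f_range; apply/mem_set; exists x. Qed.

Definition corestrict (x : K) : S := Sub (f x) (corestrict_subproof x).

Fact corestrict_morphism : monoid_morphism corestrict.
Proof.
split; first by apply: val_inj; rewrite val1; exact: gmulf1.
by move=> x y; apply: val_inj; rewrite valM; exact: gmulfM.
Qed.

HB.instance Definition _ :=
  isUMagmaMorphism.Build K S corestrict corestrict_morphism.

Fact corestrict_inv_subproof (u : S) : exists x, f x = \val u.
Proof.
have : range f (\val u) by rewrite -f_range; exact/set_mem/(valP u).
by move=> [x _ fx]; exists x.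
Qed.

Definition corestrict_inv (u : S) : K := sval (cid (corestrict_inv_subproof u)).

Lemma corestrict_invK u : f (corestrict_inv u) = \val u.
Proof. by rewrite /corestrict_inv; case: cid. Qed.

Fact corestrict_inv_morphism : monoid_morphism corestrict_inv.
Proof.
split; first by apply: f_inj; rewrite corestrict_invK val1 gmulf1.
by move=> x y; apply: f_inj; rewrite gmulfM !corestrict_invK valM.
Qed.

HB.instance Definition _ :=
  isUMagmaMorphism.Build S K corestrict_inv corestrict_inv_morphism.

Lemma sf_transport (X : subfunctor) :
  [set \val u | u in subm_set (X S)] = f @` subm_set (X K).
Proof.
apply/seteqP; split=> [_ [u Xu <-]|_ [x Xx <-]].
  by exists (corestrict_inv u); [exact: sf_hom|exact: corestrict_invK].
by exists (corestrict x); [exact: sf_hom|].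
Qed.

End Transport.

Lemma sf_comp1f : left_id sf_I sf_comp.
Proof.
move=> X; apply/subfunctorP => M; apply/seteqP; split.
  by move=> _ [u _ <-]; exact/set_mem/(valP u).
by move=> x /mem_set Xx; exists (Sub x Xx).
Qed.

Lemma sf_compf1 : right_id sf_I sf_comp.
Proof.
move=> X; apply/subfunctorP => M; rewrite /= /sf_comp_set.
by rewrite (@sf_transport M M idfun) ?image_id.
Qed.

Lemma sf_compA : associative sf_comp.
Proof.
move=> X Y Z; apply/subfunctorP => M; rewrite /= /sf_comp_set.
pose f : Y (Z M) -> M := (\val : Z M -> M) \o (\val : Y (Z M) -> Z M).
rewrite (@sf_transport (Y (Z M)) M f); first by rewrite image_comp.
  exact/inj_comp/val_inj/val_inj.
apply/seteqP; split=> [_ [u Yu <-]|_ [v _ <-]].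
  by exists (Sub u (mem_set Yu)).
by exists (\val v) => //; exact/set_mem/(valP v).
Qed.

(* Main.v *)
Require Import Defs.
From HB Require Import structures.
From mathcomp Require Import all_boot.
From mathcomp Require Import boolp classical_sets.

(** Below, [X <=s Y] means that [X M] is contained in [Y M] for every monoid [M],
    and [E'] is the composite of [E] after [GLR]: [E' M] is generated by the
    idempotents that are products of one-sided units ([sf_EGLR]).

    Upper bound.  Apart from [I], the elements of the generated monoid are the
    joins of an idempotent part, one of [O], [E'], [E], with a unit part, one
    of [O], [G], [GL], [GR], [GLR] ([normal]).  These are 15 joins, but [E']
    and [O] give the same join with [GLR], so 14 functors are left, and [I] is
    the fifteenth.  Since [X |-> X o Y] commutes with joins
    ([comp_join]), closure under composition only asks for the composites of
    [E], [G], [GL], [GR] after a normal functor [Y].  Composition is monotone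
    in both arguments, so each of them is found by squeezing [Y] between two
    functors for which the composite is known.  The facts that feed this are:
    - an idempotent one-sided unit is [1], so [E] after [GL] or [GR] is [O];
    - if a product of idempotents and left units is a right unit then all its
      factors are units: the first factor is a right unit, hence a unit, and
      can be cancelled ([right_unit_in_FL]).  The inverse of a left unit of
      [FL M] taken in [FL M] is a right unit, so [FL M] has only two-sided
      units, and dually for [FR M];
    - by the same cancellation, one-sided units of [E M] are trivial;
    - once both [GL M] and [GR M] lie in [Y M], a left or right unit of [M]
      has its one-sided inverse in [Y M].

    Lower bound.  For [X] among the 15 functors, record which of [E], [G], [GL],
    [GR], [E'], [I] lie below [X].  The 15 resulting rows are distinct
    ([signatureE]).  A negative entry comes from an upper bound of [X]
    that fails to contain the functor in question: [E] is not below [GLR] and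
    [I] is not below [FLR] in the multiplicative monoid of natural numbers; [G]
    is not below [E], [GL] not below [FR], [GR] not below [FL], and [E'] neither
    below [GL] nor below [GR], in the monoid of self-maps of the natural
    numbers. *)

Set Implicit Arguments.
Unset Strict Implicit.
Unset Printing Implicit Defensive.

Local Open Scope classical_set_scope.
Local Open Scope group_scope.

(** * Inclusion and joins of subfunctors *)

Definition sf_le (X Y : subfunctor) : Prop :=
  forall M : monoidType, subm_set (X M) `<=` subm_set (Y M).

Local Notation "X <=s Y" := (sf_le X Y) (at level 70, no associativity).
Local Notation "X \os Y" := (sf_comp X Y) (at level 50, left associativity).

Lemma sf_le_refl X : X <=s X.
Proof. by move=> M x. Qed.

#[local] Hint Resolve sf_le_refl : core.

Lemma sf_le_trans Y X Z : X <=s Y -> Y <=s Z -> X <=s Z.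
Proof. by move=> XY YZ M x /XY /YZ. Qed.

Lemma sf_le_anti X Y : X <=s Y -> Y <=s X -> X = Y.
Proof. by move=> XY YX; apply/subfunctorP => M; apply/seteqP. Qed.

Lemma le_O X : sf_O <=s X.
Proof. by move=> M _ ->; exact: subm1. Qed.

Lemma le_I X : X <=s sf_I.
Proof. by move=> M x. Qed.

Lemma generated_sub (M : monoidType) (A : set M) (S : submonoid M) :
  A `<=` subm_set S -> subm_set (generated A) `<=` subm_set S.
Proof. exact: smallest_sub (subm_closed S). Qed.

Lemma sub_generated (M : monoidType) (A : set M) : A `<=` subm_set (generated A).
Proof. exact: sub_gen_smallest. Qed.

Lemma join_le X Y Z : X <=s Z -> Y <=s Z -> sf_join X Y <=s Z.
Proof. by move=> XZ YZ M; apply: generated_sub => x [/XZ|/YZ]. Qed.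

Lemma le_joinl X Y Z : Z <=s X -> Z <=s sf_join X Y.
Proof. by move=> ZX M x /ZX Xx; apply: sub_generated; left. Qed.

Lemma le_joinr X Y Z : Z <=s Y -> Z <=s sf_join X Y.
Proof. by move=> ZY M x /ZY Yx; apply: sub_generated; right. Qed.

Lemma join_idPl X Y : Y <=s X -> sf_join X Y = X.
Proof.
by move=> YX; apply: sf_le_anti; [exact: join_le|exact: le_joinl].
Qed.

Lemma join_idPr X Y : X <=s Y -> sf_join X Y = Y.
Proof.
by move=> XY; apply: sf_le_anti; [exact: join_le|exact: le_joinr].
Qed.

Lemma join3E X Y Z : sf_join3 X Y Z = sf_join X (sf_join Y Z).
Proof.
apply: sf_le_anti => [M|].
  apply: generated_sub => x [[Xx|Yx]|Zx].
  - exact: le_joinl Xx.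
  - by apply: le_joinr Yx; exact: le_joinl.
  - by apply: le_joinr Zx; exact: le_joinr.
apply: join_le => [M x Xx|]; first by apply: sub_generated; left; left.
by apply: join_le => M x Ax; apply: sub_generated; [left; right|right].
Qed.

Lemma FLR_E : sf_FLR = sf_join sf_E sf_GLR.
Proof. exact: join3E. Qed.

(** * Composition, order and joins *)

Lemma comp_le_left X Y : X \os Y <=s Y.
Proof. by move=> M _ [u _ <-]; exact/set_mem/(valP u). Qed.

Lemma comp_le X1 X2 Y : X1 <=s X2 -> X1 \os Y <=s X2 \os Y.
Proof. by move=> X12 M _ [u /X12 Xu <-]; exists u. Qed.

Section Inclusion.
Variables (M : monoidType) (S T : submonoid M).
Hypothesis sST : subm_set S `<=` subm_set T.

Definition inclusion (u : S) : T :=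
  Sub (\val u) (mem_set (sST (set_mem (valP u)))).

Fact inclusion_morphism : monoid_morphism inclusion.
Proof.
split; first by apply: val_inj; rewrite val1; exact: val1.
by move=> u v; apply: val_inj; rewrite valM; exact: valM.
Qed.

HB.instance Definition _ :=
  isUMagmaMorphism.Build S T inclusion inclusion_morphism.

End Inclusion.

(** The inclusion of [Y1 M] in [Y2 M] is a homomorphism and [X] acts on it. *)
Lemma comp_le_mono X Y1 Y2 : Y1 <=s Y2 -> X \os Y1 <=s X \os Y2.
Proof.
move=> Y12 M _ [u Xu <-]; exists (inclusion (@Y12 M) u) => //.
exact: sf_hom Xu.
Qed.

Lemma comp_le_right X Y : X \os Y <=s X.
Proof. by rewrite -[X in _ <=s X]sf_compf1; exact: comp_le_mono. Qed.

Lemma comp_squeeze X Y1 Y Y2 Z :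
  Y1 <=s Y -> Y <=s Y2 -> Z <=s X \os Y1 -> X \os Y2 <=s Z -> X \os Y = Z.
Proof.
move=> Y1Y YY2 ZY1 Y2Z; apply: sf_le_anti.
  exact: sf_le_trans (comp_le_mono YY2) Y2Z.
exact: sf_le_trans ZY1 (comp_le_mono Y1Y).
Qed.

(** The inclusion of [Y M] in [M] is a homomorphism, so it maps a generated
    submonoid into the submonoid generated by the image. *)
Lemma comp_join X1 X2 Y :
  sf_join X1 X2 \os Y = sf_join (X1 \os Y) (X2 \os Y).
Proof.
apply: sf_le_anti => [M _ [u Xu <-]|].
  apply: (generated_hom (f := \val : Y M -> M)) Xu => v Xv.
  by case: Xv => Xv; [left|right]; exists v.
by apply: join_le; apply: comp_le; [exact: le_joinl|exact: le_joinr].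
Qed.

(** * One-sided units *)

Lemma idem_left_unit (M : monoidType) (e : M) :
  idempotents e -> left_units e -> e = 1.
Proof. by move=> ee [a ae]; rewrite -[LHS]mul1g -ae -mulgA ee. Qed.

Lemma idem_right_unit (M : monoidType) (e : M) :
  idempotents e -> right_units e -> e = 1.
Proof. by move=> ee [a ea]; rewrite -[LHS]mulg1 -ea mulgA ee. Qed.

(** If [y * z] is a right unit then so is [y]; then [y] is left invertible, so
    it can be cancelled and [z] is a right unit too. *)
Lemma right_unit_generated (M : monoidType) (U : submonoid M) (A : set M) :
    subm_set U `<=` @left_units M -> A `&` @right_units M `<=` subm_set U ->
  subm_set (generated A) `&` @right_units M `<=` subm_set U.
Proof.
move=> UL AU x [Ax]; move: x Ax.
apply: smallest_sub => [|x Ax xR]; last exact: AU.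
apply: monoid_closedP => [_|y z yU zU [c yzc]]; first exact: subm1.
have Uy : subm_set U y by apply: yU; exists (z * c); rewrite mulgA.
apply: submM => //; apply: zU.
have [b yb] := UL _ Uy.
exists (c * y).
by rewrite -[z]mul1g -yb -!(mulgA b) (mulgA (y * z)) yzc mul1g.
Qed.

Lemma left_unit_generated (M : monoidType) (U : submonoid M) (A : set M) :
    subm_set U `<=` @right_units M -> A `&` @left_units M `<=` subm_set U ->
  subm_set (generated A) `&` @left_units M `<=` subm_set U.
Proof.
move=> UR AU x [Ax]; move: x Ax.
apply: smallest_sub => [|x Ax xL]; last exact: AU.
apply: monoid_closedP => [_|y z yU zU [c cyz]]; first exact: subm1.
have Uz : subm_set U z by apply: zU; exists (c * y); rewrite -mulgA.
apply: submM => //; apply: yU.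
have [b zb] := UR _ Uz.
exists (z * c); rewrite -mulgA.
by rewrite -[y]mulg1 -zb (mulgA y) (mulgA c) cyz mul1g.
Qed.

Lemma right_unit_in_E (M : monoidType) (x : M) :
  subm_set (sf_E M) x -> right_units x -> x = 1.
Proof.
move=> Ex xR; suff : subm_set (sf_O M) x by [].
apply: (right_unit_generated (A := @idempotents M)) (conj Ex xR) => y.
  by move=> ->; exact: (subm1 (sf_GL M)).
by case; exact: idem_right_unit.
Qed.

(** Among the generators of [FL M], those from [GL M] that are right units are
    units, and those from [E M] that are right units are [1]. *)
Lemma right_unit_in_FL (M : monoidType) (x : M) :
  subm_set (sf_FL M) x -> right_units x -> subm_set (sf_G M) x.
Proof.
move=> Fx xR; apply: (right_unit_generated (U := sf_G M)) (conj Fx xR).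
  by move=> y [].
by move=> y [[/right_unit_in_E Ey /Ey ->|yL yR //]]; exact: subm1.
Qed.

Lemma left_unit_in_E (M : monoidType) (x : M) :
  subm_set (sf_E M) x -> left_units x -> x = 1.
Proof.
move=> Ex xL; suff : subm_set (sf_O M) x by [].
apply: (left_unit_generated (A := @idempotents M)) (conj Ex xL) => y.
  by move=> ->; exact: (subm1 (sf_GR M)).
by case; exact: idem_left_unit.
Qed.

Lemma left_unit_in_FR (M : monoidType) (x : M) :
  subm_set (sf_FR M) x -> left_units x -> subm_set (sf_G M) x.
Proof.
move=> Fx xL; apply: (left_unit_generated (U := sf_G M)) (conj Fx xL).
  by move=> y [].
by move=> y [[/left_unit_in_E Ey /Ey ->|yR yL //]]; exact: subm1.
Qed.

(** A one-sided inverse of a unit, on either side, is its two-sided inverse. *)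
Lemma G_inverse (M : monoidType) (x y : M) :
  x * y = 1 -> subm_set (sf_G M) x -> subm_set (sf_G M) y.
Proof.
move=> xy [[b bx] _]; have by1 : b = y by rewrite -[b]mulg1 -xy mulgA bx mul1g.
by split; [exists x|exists x; rewrite -by1].
Qed.

Lemma G_inverse' (M : monoidType) (x y : M) :
  x * y = 1 -> subm_set (sf_G M) y -> subm_set (sf_G M) x.
Proof.
move=> xy [_ [b yb]]; have bx1 : x = b by rewrite -[x]mulg1 -yb mulgA xy mul1g.
by split; [exists y; rewrite bx1|exists y].
Qed.

(** * The composites of [E], [G], [GL] and [GR] that feed the squeezing *)

Definition sf_EGLR : subfunctor := sf_E \os sf_GLR.

Lemma G_le_GL : sf_G <=s sf_GL.
Proof. by move=> M x []. Qed.

Lemma G_le_GR : sf_G <=s sf_GR.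
Proof. by move=> M x []. Qed.

(** Proof search for inclusions between joins of [O], [G], [GL], [GR], [EGLR]
    and [E].  Splitting a join on the left loses nothing, so it comes first; the
    side of a join on the right is guessed, possibly after going up from [G] to
    [GL] or [GR], or from [EGLR] to [E] or [GLR]. *)
Ltac incl_search :=
  lazymatch goal with
  | |- sf_join _ _ <=s _ => apply: join_le; incl_search
  | |- _ => first
    [ exact: sf_le_refl | exact: le_O | exact: le_I
    | apply: le_joinl; incl_search | apply: le_joinr; incl_search
    | apply: sf_le_trans G_le_GL _; incl_search
    | apply: sf_le_trans G_le_GR _; incl_search
    | apply: (@sf_le_trans sf_E sf_EGLR); [exact: comp_le_right|incl_search]
    | apply: (@sf_le_trans (sf_join sf_GL sf_GR) sf_EGLR);
        [exact: comp_le_left|incl_search] ]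
  end.
Ltac incl :=
  rewrite ?FLR_E /sf_GLR /sf_F /sf_FL /sf_FR; incl_search.

Lemma E_le_EE : sf_E <=s sf_E \os sf_E.
Proof.
move=> M; apply: generated_sub => e ee.
have Ee : e \in subm_set (sf_E M) by apply/mem_set; exact: sub_generated.
exists (Sub e Ee) => //; apply: sub_generated.
by apply: val_inj; rewrite valM.
Qed.

Lemma EGLR_le_E_EGLR : sf_EGLR <=s sf_E \os sf_EGLR.
Proof. by rewrite /sf_EGLR sf_compA; exact/comp_le/E_le_EE. Qed.

Lemma E_GL_le_O : sf_E \os sf_GL <=s sf_O.
Proof.
move=> M _ [u Eu <-]; suff -> : u = 1 by exact: val1.
move: u Eu; apply: (generated_sub (S := sf_O (sf_GL M))) => e ee.
apply: val_inj; rewrite val1; apply: idem_left_unit.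
  exact: (idempotents_hom (\val : sf_GL M -> M) ee).
exact/set_mem/(valP e).
Qed.

Lemma E_GR_le_O : sf_E \os sf_GR <=s sf_O.
Proof.
move=> M _ [u Eu <-]; suff -> : u = 1 by exact: val1.
move: u Eu; apply: (generated_sub (S := sf_O (sf_GR M))) => e ee.
apply: val_inj; rewrite val1; apply: idem_right_unit.
  exact: (idempotents_hom (\val : sf_GR M -> M) ee).
exact/set_mem/(valP e).
Qed.

Inductive unit_functor : subfunctor -> Prop :=
| unit_functor_G : unit_functor sf_G
| unit_functor_GL : unit_functor sf_GL
| unit_functor_GR : unit_functor sf_GR.

Lemma G_le_unit_functor X : unit_functor X -> sf_G <=s X.
Proof. by case=> M x []. Qed.

(** A one-sided unit of [Y M] and its one-sided inverse in [Y M] are the two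
    factors of a product equal to [1], so one condition on such pairs bounds
    all three composites. *)
Lemma unit_functor_comp_le (X Y U : subfunctor) :
    (forall (M : monoidType) (x y : M), subm_set (Y M) x -> subm_set (Y M) y ->
      x * y = 1 -> subm_set (U M) x /\ subm_set (U M) y) ->
  unit_functor X -> X \os Y <=s U.
Proof.
move=> YU.
have GLU : sf_GL \os Y <=s U.
  move=> M _ [u [a au] <-].
  have [] // := YU M (\val a) (\val u).
  - exact/set_mem/(valP a).
  - exact/set_mem/(valP u).
  - by rewrite -valM au val1.
case=> //; first exact: sf_le_trans (comp_le G_le_GL) GLU.
move=> M _ [u [a ua] <-].
have [] // := YU M (\val u) (\val a).
- exact/set_mem/(valP u).
- exact/set_mem/(valP a).
- by rewrite -valM ua val1.
Qed.

Lemma unit_functor_E X : unit_functor X -> X \os sf_E <=s sf_O.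
Proof.
apply: unit_functor_comp_le => M x y Ex _ xy.
have x1 : x = 1 by apply: right_unit_in_E Ex _; exists y.
by have y1 : y = 1 by rewrite -xy x1 mul1g.
Qed.

Lemma unit_functor_FL X : unit_functor X -> X \os sf_FL <=s sf_G.
Proof.
apply: unit_functor_comp_le => M x y Fx _ xy.
have Gx : subm_set (sf_G M) x by apply: right_unit_in_FL Fx _; exists y.
by split=> //; exact: G_inverse xy Gx.
Qed.

Lemma unit_functor_FR X : unit_functor X -> X \os sf_FR <=s sf_G.
Proof.
apply: unit_functor_comp_le => M x y _ Fy xy.
have Gy : subm_set (sf_G M) y by apply: left_unit_in_FR Fy _; exists x.
by split=> //; exact: G_inverse' xy Gy.
Qed.

Lemma G_le_GG : sf_G <=s sf_G \os sf_G.
Proof.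
move=> M x Gx; have [[a ax] [b xb]] := Gx.
have Ga := mem_set (G_inverse' ax Gx); have Gb := mem_set (G_inverse xb Gx).
exists (Sub x (mem_set Gx)) => //; split.
  by exists (Sub a Ga); apply: val_inj; rewrite valM val1.
by exists (Sub b Gb); apply: val_inj; rewrite valM val1.
Qed.

Lemma GL_le_GL_GLR : sf_GL <=s sf_GL \os sf_GLR.
Proof.
move=> M x xL; have [a ax] := xL.
have GLRx : subm_set (sf_GLR M) x by apply: sub_generated; left.
have GLRa : subm_set (sf_GLR M) a by apply: sub_generated; right; exists x.
exists (Sub x (mem_set GLRx)) => //.
by exists (Sub a (mem_set GLRa)); apply: val_inj; rewrite valM val1.
Qed.

Lemma GR_le_GR_GLR : sf_GR <=s sf_GR \os sf_GLR.
Proof.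
move=> M x xR; have [a xa] := xR.
have GLRx : subm_set (sf_GLR M) x by apply: sub_generated; right.
have GLRa : subm_set (sf_GLR M) a by apply: sub_generated; left; exists x.
exists (Sub x (mem_set GLRx)) => //.
by exists (Sub a (mem_set GLRa)); apply: val_inj; rewrite valM val1.
Qed.

Lemma unit_functor_GLR X : unit_functor X -> X <=s X \os sf_GLR.
Proof.
case; [|exact: GL_le_GL_GLR|exact: GR_le_GR_GLR].
by apply: sf_le_trans G_le_GG _; apply: comp_le_mono; incl.
Qed.

(** * The generated monoid consists of normal functors *)

Inductive idem_part : subfunctor -> Prop :=
| idem_part_O : idem_part sf_O
| idem_part_EGLR : idem_part sf_EGLR
| idem_part_E : idem_part sf_E.

Inductive unit_part : subfunctor -> Prop :=
| unit_part_O : unit_part sf_O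
| unit_part_G : unit_part sf_G
| unit_part_GL : unit_part sf_GL
| unit_part_GR : unit_part sf_GR
| unit_part_GLR : unit_part sf_GLR.

Inductive normal : subfunctor -> Prop :=
| normal_I : normal sf_I
| normal_join e u : idem_part e -> unit_part u -> normal (sf_join e u).

Lemma normal_idem e : idem_part e -> normal e.
Proof.
move=> He; rewrite -(join_idPl (le_O e)).
by apply: normal_join => //; exact: unit_part_O.
Qed.

Lemma normal_unit u : unit_part u -> normal u.
Proof.
move=> Hu; rewrite -(join_idPr (le_O u)).
by apply: normal_join => //; exact: idem_part_O.
Qed.

Lemma E_comp_normal Y : normal Y -> idem_part (sf_E \os Y).
Proof.
have sqE Z : sf_E <=s Z -> idem_part (sf_E \os Z).
  move=> EZ; rewrite (comp_squeeze EZ (@le_I Z) E_le_EE (@comp_le_right _ _)).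
  exact: idem_part_E.
have sqEGLR Z : sf_EGLR <=s Z -> Z <=s sf_GLR -> idem_part (sf_E \os Z).
  move=> EZ ZGLR.
  rewrite (comp_squeeze EZ ZGLR EGLR_le_E_EGLR (@sf_le_refl _)).
  exact: idem_part_EGLR.
have sqO Z W : sf_E \os W <=s sf_O -> Z <=s W -> idem_part (sf_E \os Z).
  move=> WO ZW; rewrite (comp_squeeze (@le_O Z) ZW (@le_O _) WO).
  exact: idem_part_O.
case=> [|e u [] []].
all: first [ by apply: sqE; incl | by apply: sqEGLR; incl
           | by apply: sqO E_GL_le_O _; incl | by apply: sqO E_GR_le_O _; incl ].
Qed.

Variant unit_comp_spec (Y : subfunctor) : Prop :=
| UnitCompO of forall X, unit_functor X -> X \os Y = sf_O
| UnitCompG of forall X, unit_functor X -> X \os Y = sf_G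
| UnitCompId of forall X, unit_functor X -> X \os Y = X.

(** Which case applies depends on the unit part of [Y] only: [O]; then [G],
    [GL] or [GR]; then [GLR]. *)
Lemma unit_comp_normal Y : normal Y -> unit_comp_spec Y.
Proof.
have sqO Z : Z <=s sf_E -> unit_comp_spec Z.
  move=> ZE; apply: UnitCompO => X uX.
  exact: comp_squeeze (@le_O Z) ZE (@le_O _) (unit_functor_E uX).
have G_le X : unit_functor X -> sf_G <=s X \os sf_G.
  by move=> uX; exact: sf_le_trans G_le_GG (comp_le (G_le_unit_functor uX)).
have sqFL Z : sf_G <=s Z -> Z <=s sf_FL -> unit_comp_spec Z.
  move=> GZ ZF; apply: UnitCompG => X uX.
  exact: comp_squeeze GZ ZF (G_le _ uX) (unit_functor_FL uX).
have sqFR Z : sf_G <=s Z -> Z <=s sf_FR -> unit_comp_spec Z.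
  move=> GZ ZF; apply: UnitCompG => X uX.
  exact: comp_squeeze GZ ZF (G_le _ uX) (unit_functor_FR uX).
have sqGLR Z : sf_GLR <=s Z -> unit_comp_spec Z.
  move=> GLRZ; apply: UnitCompId => X uX.
  apply: comp_squeeze GLRZ (@le_I Z) (unit_functor_GLR uX) _.
  exact: comp_le_right.
case=> [|e u He []]; first by apply: sqGLR; incl.
- by apply: sqO; case: He; incl.
- by apply: sqFL; case: He; incl.
- by apply: sqFL; case: He; incl.
- by apply: sqFR; case: He; incl.
- by apply: sqGLR; case: He; incl.
Qed.

Lemma unit_functor_comp_normal X Y :
  unit_functor X -> normal Y -> unit_part (X \os Y).
Proof.
move=> uX /unit_comp_normal[] /(_ X uX) ->.
- exact: unit_part_O.
- exact: unit_part_G.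
- by case: X / uX; constructor.
Qed.

Lemma GLR_comp_normal Y : normal Y -> unit_part (sf_GLR \os Y).
Proof.
move=> /unit_comp_normal YP; rewrite comp_join.
case: YP => YP; rewrite !YP; try by constructor.
- by rewrite join_idPl //; exact: unit_part_O.
- by rewrite join_idPl //; exact: unit_part_G.
Qed.

(** By associativity only generators [X] matter, and each of them is a join of
    some of [E], [G], [GL], [GR], or [O] or [I]. *)
Lemma Fplus_comp_normal X : Fplus X -> forall Y, normal Y -> normal (X \os Y).
Proof.
elim=> [||||||||||| X1 X2 _ IH1 _ IH2] Y nY; last first.
  by rewrite -sf_compA; exact/IH1/IH2.
all: have eY := E_comp_normal nY; have lrY := GLR_comp_normal nY.
all: have uY Z (uZ : unit_functor Z) := unit_functor_comp_normal uZ nY.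
- by rewrite sf_comp1f.
- by rewrite FLR_E comp_join; exact: normal_join.
- by rewrite comp_join; apply: normal_join => //; apply: uY; constructor.
- by rewrite comp_join; apply: normal_join => //; apply: uY; constructor.
- by rewrite comp_join; apply: normal_join => //; apply: uY; constructor.
- exact: normal_unit.
- by apply/normal_unit/uY; constructor.
- by apply/normal_unit/uY; constructor.
- by apply/normal_unit/uY; constructor.
- exact: normal_idem.
- rewrite (sf_le_anti (@comp_le_right sf_O Y) (@le_O _)).
  by apply: normal_idem; constructor.
Qed.

Lemma Fplus_normal X : Fplus X -> normal X.
Proof.
by move=> XP; rewrite -[X]sf_compf1; exact: Fplus_comp_normal XP _ normal_I.
Qed.

(** * Monoids separating the functors *)

Definition mulnat : Type := nat.

HB.instance Definition _ := Choice.copy mulnat nat.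
HB.instance Definition _ := isMonoid.Build mulnat mulnA mul1n muln1.

Lemma mulnat_left_unit (x : mulnat) : left_units x -> x = 1.
Proof. move=> [a ax]; have /eqP := ax : (a * x = 1)%N.
by rewrite muln_eq1 => /andP[_ /eqP]. Qed.

Lemma mulnat_right_unit (x : mulnat) : right_units x -> x = 1.
Proof. move=> [a xa]; have /eqP := xa : (x * a = 1)%N.
by rewrite muln_eq1 => /andP[/eqP]. Qed.

Lemma mulnat_GLR : subm_set (sf_GLR mulnat) `<=` subm_set (sf_O mulnat).
Proof.
by apply: generated_sub => x [/mulnat_left_unit|/mulnat_right_unit].
Qed.

Lemma E_not_le_GLR : ~ sf_E <=s sf_GLR.
Proof.
move=> /(_ mulnat 0%N) h; have /h/mulnat_GLR // : subm_set (sf_E mulnat) 0%N.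
exact: sub_generated.
Qed.

(** In the multiplicative monoid of natural numbers the one-sided units and the
    idempotents are at most [1], hence so are their products. *)
Lemma I_not_le_FLR : ~ sf_I <=s sf_FLR.
Proof.
move=> /(_ mulnat 2%N I); rewrite FLR_E => FLR2.
have c : monoid_closed [in [set x : mulnat | x <= 1]].
  apply: monoid_closedP => // x y x1 y1.
  exact: leq_mul x1 y1.
suff /(_ _ FLR2) : subm_set (sf_join sf_E sf_GLR mulnat) `<=` [set x | x <= 1].
  by [].
apply: (generated_sub (S := Submonoid c)) => x [|/mulnat_GLR -> //].
move: x; apply: (generated_sub (S := Submonoid c)) => -[|[|x]] //= xx.
have /eqP := xx : (x.+2 * x.+2 = x.+2)%N.
by rewrite mulSn -[eqbRHS]addn0 eqn_add2l.
Qed.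

Definition selfmap : Type := nat -> nat.

HB.instance Definition _ := Choice.copy selfmap (nat -> nat).

Definition selfmap_mul (f g : selfmap) : selfmap := f \o g.
Definition selfmap_one : selfmap := id.

Fact selfmap_mulA : associative selfmap_mul.
Proof. by []. Qed.
Fact selfmap_mul1 : left_id selfmap_one selfmap_mul.
Proof. by []. Qed.
Fact selfmap_mulr1 : right_id selfmap_one selfmap_mul.
Proof. by []. Qed.

HB.instance Definition _ :=
  isMonoid.Build selfmap selfmap_mulA selfmap_mul1 selfmap_mulr1.

Lemma pred_succ : (predn : selfmap) * (succn : selfmap) = 1.
Proof. by []. Qed.

Lemma succ_left_unit : left_units (succn : selfmap).
Proof. by exists predn; exact: pred_succ. Qed.

Lemma pred_right_unit : right_units (predn : selfmap).
Proof. by exists succn; exact: pred_succ. Qed.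

Lemma GL_not_le_FR : ~ sf_GL <=s sf_FR.
Proof.
move=> /(_ selfmap succn succ_left_unit) /left_unit_in_FR.
by move=> /(_ succ_left_unit) [_ [g /(congr1 (fun h : selfmap => h 0%N))]].
Qed.

Lemma GR_not_le_FL : ~ sf_GR <=s sf_FL.
Proof.
move=> /(_ selfmap predn pred_right_unit) /right_unit_in_FL.
move=> /(_ pred_right_unit) [[g gp] _].
have g0 : g 0%N = 0%N := congr1 (fun h : selfmap => h 0%N) gp.
have g1 : g 0%N = 1%N := congr1 (fun h : selfmap => h 1%N) gp.
by rewrite g0 in g1.
Qed.

Definition swap01 : selfmap := fun n => if n is n'.+2 then n else 1 - n.

Lemma G_not_le_E : ~ sf_G <=s sf_E.
Proof.
have ss : swap01 * swap01 = 1 by apply/funext => -[|[|n]].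
have sR : right_units swap01 by exists swap01.
have sG : subm_set (sf_G selfmap) swap01 by split; [exists swap01|].
move=> /(_ selfmap swap01 sG) /right_unit_in_E /(_ sR).
by move=> /(congr1 (fun h : selfmap => h 0%N)).
Qed.

Definition succ_pred : selfmap := (succn : selfmap) * (predn : selfmap).

Lemma succ_pred_idem : idempotents succ_pred.
Proof. by apply/funext => -[]. Qed.

Lemma succ_pred_neq1 : succ_pred <> 1.
Proof. by move=> /(congr1 (fun h : selfmap => h 0%N)). Qed.

Lemma succ_pred_EGLR : subm_set (sf_EGLR selfmap) succ_pred.
Proof.
have GLRsp : subm_set (sf_GLR selfmap) succ_pred.
  apply: submM; apply: sub_generated; [left|right].
    exact: succ_left_unit.
  exact: pred_right_unit.
exists (Sub succ_pred (mem_set GLRsp)) => //; apply: sub_generated.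
by apply: val_inj; rewrite valM; exact: succ_pred_idem.
Qed.

Lemma EGLR_not_le_GL : ~ sf_EGLR <=s sf_GL.
Proof.
move=> /(_ selfmap _ succ_pred_EGLR) /(idem_left_unit succ_pred_idem).
exact: succ_pred_neq1.
Qed.

Lemma EGLR_not_le_GR : ~ sf_EGLR <=s sf_GR.
Proof.
move=> /(_ selfmap _ succ_pred_EGLR) /(idem_right_unit succ_pred_idem).
exact: succ_pred_neq1.
Qed.

(** * The fifteen functors *)

Definition fifteen : seq subfunctor :=
  [:: sf_O; sf_G; sf_GL; sf_GR; sf_GLR;
      sf_EGLR; sf_join sf_EGLR sf_G; sf_join sf_EGLR sf_GL;
      sf_join sf_EGLR sf_GR;
      sf_E; sf_F; sf_FL; sf_FR; sf_FLR;
      sf_I].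

Definition signature (X : subfunctor) : seq bool :=
  [:: `[< sf_E <=s X >]; `[< sf_G <=s X >]; `[< sf_GL <=s X >];
      `[< sf_GR <=s X >]; `[< sf_EGLR <=s X >]; `[< sf_I <=s X >]].

Lemma signatureE : map signature fifteen =
  [:: [:: false; false; false; false; false; false];
      [:: false; true;  false; false; false; false];
      [:: false; true;  true;  false; false; false];
      [:: false; true;  false; true;  false; false];
      [:: false; true;  true;  true;  true;  false];
      [:: false; false; false; false; true;  false];
      [:: false; true;  false; false; true;  false];
      [:: false; true;  true;  false; true;  false];
      [:: false; true;  false; true;  true;  false];
      [:: true;  false; false; false; true;  false];
      [:: true;  true;  false; false; true;  false];
      [:: true;  true;  true;  false; true;  false];
      [:: true;  true;  false; true;  true;  false];
      [:: true;  true;  true;  true;  true;  false];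
      [:: true;  true;  true;  true;  true;  true]].
Proof.
have not_le X Y Z : ~ X <=s Y -> Z <=s Y -> `[< X <=s Z >] = false.
  by move=> XY ZY; apply/asboolPn => XZ; apply: XY; exact: sf_le_trans XZ ZY.
Ltac entry not_le := lazymatch goal with
  | |- _ = true => apply: asboolT; incl
  | |- _ = false => first
    [ apply: not_le E_not_le_GLR _; incl | apply: not_le G_not_le_E _; incl
    | apply: not_le GL_not_le_FR _; incl | apply: not_le GR_not_le_FL _; incl
    | apply: not_le EGLR_not_le_GL _; incl
    | apply: not_le EGLR_not_le_GR _; incl
    | apply: not_le I_not_le_FLR _; incl ]
  end.
rewrite /= /signature.
by do ![congr (_ :: _)]; entry not_le.
Qed.

Lemma Fplus_fifteen (i : 'I_15) : Fplus (nth sf_I fifteen i).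
Proof.
have FGLR : Fplus sf_GLR := Fplus_GLR.
have FEGLR : Fplus sf_EGLR by apply: Fplus_comp FGLR; exact: Fplus_E.
have unitE X : unit_functor X -> X \os sf_GLR = X.
  by move=> uX; apply: sf_le_anti (unit_functor_GLR uX); exact: comp_le_right.
have FJ X : unit_functor X -> Fplus (sf_join sf_E X) ->
    Fplus (sf_join sf_EGLR X).
  by move=> uX FX; rewrite -(unitE _ uX) -comp_join; exact: Fplus_comp.
by case: i => -[|[|[|[|[|[|[|[|[|[|[|[|[|[|[|i]]]]]]]]]]]]]]] ilt //=;
  first [constructor|apply: FJ; constructor].
Qed.

Lemma normal_fifteen X :
  normal X -> exists i : 'I_15, nth sf_I fifteen i = X.
Proof.
case=> [|e u]; first by exists (@Ordinal 15 14 isT).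
case=> [] [] /=.
- by exists (@Ordinal 15 0 isT); rewrite join_idPr //; exact: le_O.
- by exists (@Ordinal 15 1 isT); rewrite join_idPr //; exact: le_O.
- by exists (@Ordinal 15 2 isT); rewrite join_idPr //; exact: le_O.
- by exists (@Ordinal 15 3 isT); rewrite join_idPr //; exact: le_O.
- by exists (@Ordinal 15 4 isT); rewrite join_idPr //; exact: le_O.
- by exists (@Ordinal 15 5 isT); rewrite join_idPl //; exact: le_O.
- by exists (@Ordinal 15 6 isT).
- by exists (@Ordinal 15 7 isT).
- by exists (@Ordinal 15 8 isT).
- by exists (@Ordinal 15 4 isT); rewrite join_idPr //; exact: comp_le_left.
- by exists (@Ordinal 15 9 isT); rewrite join_idPl //; exact: le_O.
- by exists (@Ordinal 15 10 isT).
- by exists (@Ordinal 15 11 isT).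
- by exists (@Ordinal 15 12 isT).
- by exists (@Ordinal 15 13 isT); rewrite -FLR_E.
Qed.

Theorem proposition5p6 :
  exists F : 'I_15 -> subfunctor,
    injective F /\ (forall X : subfunctor, Fplus X <-> exists i : 'I_15, F i = X).
Proof.
exists (fun i => nth sf_I fifteen i); split.
  move=> i j /(congr1 signature).
  rewrite -!(nth_map _ [::]) ?signatureE //.
  by move=> /eqP; rewrite nth_uniq // => /eqP/val_inj.
move=> X; split=> [/Fplus_normal/normal_fifteen //|[i <-]].
exact: Fplus_fifteen.
Qed.
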